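(* Let $Q$ be a left quasigroup with the spelling property. The assignments $\alpha\mapsto\mathrm{Dis}_\alpha$ and $N\mapsto\mathrm{con}_N$ form a monotone Galois connection between $\mathrm{Con}(Q)$ and the lattice of the normal subgroups of $\mathrm{LMlt}(Q)$ (both ordered by inclusion). That is, $\mathrm{con}_N\in\mathrm{Con}(Q)$ for every $N\trianglelefteq\mathrm{LMlt}(Q)$, $\mathrm{Dis}_\alpha\trianglelefteq\mathrm{LMlt}(Q)$ for every $\alpha\in\mathrm{Con}(Q)$, both assignments are monotone, and for all $\alpha\in\mathrm{Con}(Q)$ and $N\trianglelefteq\mathrm{LMlt}(Q)$, $$\mathrm{Dis}_\alpha\leq N\iff\alpha\leq\mathrm{con}_N.$$
   Context: A left quasigroup is a (nonempty) set $Q$ with binary operations $*,\backslash$ such that $x*(x\backslash y)=y=x\backslash(x*y)$; equivalently every $L_x:y\mapsto x*y$ is a bijection, and $x\backslash y=L_x^{-1}(y)$. $\mathrm{Con}(Q)$ is the lattice of congruences (equivalence relations compatible with $*$ and $\backslash$). $\mathrm{LMlt}(Q)=\langle L_a: a\in Q\rangle$. $Q$ has the spelling property if there exist two binary terms $w^{+},w^{-}$ in the language of groups such that $L_{x*y}=w^{+}(L_x,L_y)$ and $L_{x\backslash y}=w^{-}(L_x,L_y)$ for all $x,y\in Q$. For an equivalence relation $\alpha$ on $Q$, $\mathrm{Dis}_\alpha$ is the normal closure in $\mathrm{LMlt}(Q)$ of $\{L_aL_b^{-1}: a\,\alpha\,b\}$. For $N\leq\mathrm{LMlt}(Q)$,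 $\mathrm{con}_N=\{(a,b)\in Q^2: L_aL_b^{-1}\in N\}$. *)

(* Defs.v *)
(* The groups here may be infinite, so subgroups are classical sets rather than
   the {group gT} of finite group theory. *)
From HB Require Import structures.
From mathcomp Require Import all_boot.
From mathcomp Require Import boolp classical_sets.
Set Implicit Arguments.
Unset Strict Implicit.
Unset Printing Implicit Defensive.

Local Open Scope classical_set_scope.
Local Open Scope group_scope.

HB.mixin Record isLeftQuasigroup (Q : Type) := {
  lmul : Q -> Q -> Q;
  ldiv : Q -> Q -> Q;
  ldivK : forall x y, lmul x (ldiv x y) = y;
  lmulK : forall x y, ldiv x (lmul x y) = y;
  lquasigroup_inhabited : inhabited Q
}.

#[short(type="leftQuasigroupType")]
HB.structure Definition LeftQuasigroup := {Q of isLeftQuasigroup Q}.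

Record sym (T : Type) := Sym {
  sym_fun :> T -> T;
  sym_inv : T -> T;
  sym_funK : cancel sym_fun sym_inv;
  sym_invK : cancel sym_inv sym_fun
}.

Section SymmetricGroup.
Variable T : Type.
Implicit Types f g h : sym T.

Lemma sym_ext f g : sym_fun f =1 sym_fun g -> f = g.
Proof.
case: f g => [f f' fK f'K] [g g' gK g'K] /= /funext fg.
case: g / fg gK g'K => gK g'K.
have e : f' = g' by apply/funext => x; rewrite -{1}(g'K x) fK.
case: g' / e gK g'K => gK g'K.
by rewrite (Prop_irrelevance gK fK) (Prop_irrelevance g'K f'K).
Qed.

Definition sym_one : sym T := @Sym T id id (fun=> erefl) (fun=> erefl).

(* Maps act on the left: (f * g) x = f (g x), unlike {perm T} where the
   left factor is applied first. *)
Definition sym_mul f g : sym T :=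
  Sym (can_comp (sym_funK f) (sym_funK g))
      (can_comp (sym_invK g) (sym_invK f)).

Definition sym_invg f : sym T := Sym (sym_invK f) (sym_funK f).

Fact sym_mulA : associative sym_mul.
Proof. by move=> f g h; apply: sym_ext. Qed.

Fact sym_mul1 : left_id sym_one sym_mul.
Proof. by move=> f; apply: sym_ext. Qed.

Fact sym_mulr1 : right_id sym_one sym_mul.
Proof. by move=> f; apply: sym_ext. Qed.

Fact sym_mulV : left_inverse sym_one sym_invg sym_mul.
Proof. by move=> f; apply: sym_ext => x /=; rewrite sym_funK. Qed.

Fact sym_mulrV : right_inverse sym_one sym_invg sym_mul.
Proof. by move=> f; apply: sym_ext => x /=; rewrite sym_invK. Qed.

HB.instance Definition _ := gen_eqMixin (sym T).
HB.instance Definition _ := gen_choiceMixin (sym T).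
HB.instance Definition _ :=
  isGroup.Build (sym T) sym_mulA sym_mul1 sym_mulr1 sym_mulV sym_mulrV.

End SymmetricGroup.

Section Subgroups.
Variable gT : groupType.
Implicit Types (A G N : set gT).

Definition subgroup A : Prop := group_closed [in A].

Definition generated A : set gT := smallest subgroup A.

Definition normal_subgroup G N : Prop :=
  [/\ subgroup N, N `<=` G & forall g n, G g -> N n -> N (n ^ g)].

Definition normal_closure G A : set gT := smallest (normal_subgroup G) A.

End Subgroups.

Inductive group_term2 : Type :=
| GVar1 | GVar2 | GOne
| GMul of group_term2 & group_term2
| GInv of group_term2.

Fixpoint eval_group_term2 (gT : groupType) (a b : gT) (w : group_term2) : gT :=
  match w with
  | GVar1 => a
  | GVar2 => b
  | GOne => 1
  | GMul u v => eval_group_term2 a b u * eval_group_term2 a b v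
  | GInv u => (eval_group_term2 a b u)^-1
  end.

Section LeftQuasigroupTheory.
Variable Q : leftQuasigroupType.

Definition ltrans (x : Q) : sym Q := Sym (lmulK x) (ldivK x).

Definition LMlt : set (sym Q) := generated (range ltrans).

Definition spelling_property : Prop :=
  exists wp wm : group_term2, forall x y : Q,
    ltrans (lmul x y) = eval_group_term2 (ltrans x) (ltrans y) wp /\
    ltrans (ldiv x y) = eval_group_term2 (ltrans x) (ltrans y) wm.

Record congruence (alpha : set (Q * Q)) : Prop := Congruence {
  congr_refl : forall x, alpha (x, x);
  congr_sym : forall x y, alpha (x, y) -> alpha (y, x);
  congr_trans : forall x y z, alpha (x, y) -> alpha (y, z) -> alpha (x, z);
  congr_lmul : forall x x' y y', alpha (x, x') -> alpha (y, y') ->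
    alpha (lmul x y, lmul x' y');
  congr_ldiv : forall x x' y y', alpha (x, x') -> alpha (y, y') ->
    alpha (ldiv x y, ldiv x' y')
}.

Definition Dis (alpha : set (Q * Q)) : set (sym Q) :=
  normal_closure LMlt
    [set ltrans ab.1 * (ltrans ab.2)^-1 | ab in alpha].

Definition con (N : set (sym Q)) : set (Q * Q) :=
  [set ab | N (ltrans ab.1 * (ltrans ab.2)^-1)].

End LeftQuasigroupTheory.

Arguments LMlt Q : clear implicits.
Arguments spelling_property Q : clear implicits.

(* Main.v *)
(* Modulo a normal subgroup N of LMlt(Q), evaluation of a group term on elements
   of LMlt(Q) depends only on the cosets of its arguments.  By the spelling
   property L_{x*y} and L_{x\y} are such values, so con_N is compatible with
   both operations.  The adjunction is the universal property of the normal
   closure. *)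
Require Import Defs.
From mathcomp Require Import all_boot.
From mathcomp Require Import boolp classical_sets.
Local Open Scope classical_set_scope.

Section Subgroups.
Local Open Scope group_scope.
Context {gT : groupType}.
Implicit Types (A B G N : set gT) (a b c g n : gT).

(** Moves [group_closed], stated with boolean membership [[in A]], to the [Prop] membership of
    classical sets. *)
Lemma subgroupP A :
  subgroup A <-> A 1 /\ (forall a b, A a -> A b -> A (a / b)).
Proof.
split=> [[/set_mem A1 AD]|[A1 AD]].
  by split=> // a b /mem_set Aa /mem_set Ab; apply/set_mem/AD.
by split=> [|a b /set_mem Aa /set_mem Ab]; apply/mem_set => //; apply: AD.
Qed.

Lemma subgroup1 {A} : subgroup A -> A 1.
Proof. by case/subgroupP. Qed.

Lemma subgroup_div {A a b} : subgroup A -> A a -> A b -> A (a / b).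
Proof. by case/subgroupP=> _; apply. Qed.

Lemma subgroupV {A a} : subgroup A -> A a -> A a^-1.
Proof. by move=> sA Aa; rewrite -div1g; apply: subgroup_div (subgroup1 sA) _. Qed.

Lemma subgroupM {A a b} : subgroup A -> A a -> A b -> A (a * b).
Proof.
by move=> sA Aa Ab; rewrite -[b]invgK; apply: subgroup_div => //; apply: subgroupV.
Qed.

(** Both [generated] and [normal_closure] are such intersections, through [smallest]. *)
Lemma subgroup_bigcap (F : set (set gT)) :
  (forall A, F A -> subgroup A) -> subgroup (\bigcap_(A in F) A).
Proof.
move=> sF; apply/subgroupP; split=> [A FA|a b Fa Fb A FA].
  exact/subgroup1/sF.
by apply: subgroup_div (sF A FA) (Fa A FA) (Fb A FA).
Qed.

Lemma generated_subgroup A : subgroup (generated A).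
Proof. by apply: subgroup_bigcap => B []. Qed.

(** Puts [G] itself in the family intersected by [normal_closure G A] when [A] lies in [G], which
    bounds the closure by [G]. *)
Lemma normal_subgroup_refl G : subgroup G -> normal_subgroup G G.
Proof.
move=> sG; split=> // g n Gg Gn; rewrite conjgE.
by do ?[apply: subgroupM => //]; apply: subgroupV.
Qed.

(* Without A `<=` G no normal subgroup of G contains A, and the closure
   degenerates to the full set. *)
Lemma normal_closure_normal G A :
  subgroup G -> A `<=` G -> normal_subgroup G (normal_closure G A).
Proof.
move=> sG AG; split.
- by apply: subgroup_bigcap => B [[]].
- by apply: smallest_sub => //; apply: normal_subgroup_refl.
- by move=> g n Gg An B BA; case: (BA) => -[_ _ nB] _; apply: nB => //; apply: An.
Qed.

Lemma eval_group_term2_subgroup G a b (w : group_term2) :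
  subgroup G -> G a -> G b -> G (eval_group_term2 a b w).
Proof.
move=> sG Ga Gb; elim: w => //= [|u Gu v Gv|u Gu].
- exact: subgroup1.
- exact: subgroupM.
- exact: subgroupV.
Qed.

(** Since [n ^ g] is [g^-1 * n * g], conjugation on the other side is conjugation by [g^-1]. *)
Lemma normal_subgroup_conjV {G N g n} :
  subgroup G -> normal_subgroup G N -> G g -> N n -> N (g * n / g).
Proof.
move=> sG [_ _ nN] Gg Nn.
by have := nN _ _ (subgroupV sG Gg) Nn; rewrite conjgE invgK mulgA.
Qed.

Lemma eval_group_term2_coset {G N a a' b b'} (w : group_term2) :
  subgroup G -> normal_subgroup G N -> G a -> G a' -> G b -> G b' ->
  N (a / a') -> N (b / b') ->
  N (eval_group_term2 a b w / eval_group_term2 a' b' w).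
Proof.
move=> sG nN Ga Ga' Gb Gb' Naa' Nbb'; have [sN _ conjN] := nN.
elim: w => //= [|u Nu v Nv|u Nu].
- by rewrite mulgV; apply: subgroup1.
- set x := eval_group_term2 a b u in Nu *; set x' := eval_group_term2 a' b' u in Nu *.
  set y := eval_group_term2 a b v in Nv *; set y' := eval_group_term2 a' b' v in Nv *.
  (* Inserting [x^-1 * x] isolates a conjugate of [y / y'] by [x], which lies in [G] as the value of
     a term. *)
  have -> : x * y / (x' * y') = (x * (y / y') / x) * (x / x').
    by rewrite invgM !mulgA mulgVK.
  apply: subgroupM => //; apply: (normal_subgroup_conjV sG nN) => //.
  exact: eval_group_term2_subgroup.
- set x := eval_group_term2 a b u in Nu *; set x' := eval_group_term2 a' b' u in Nu *.
  (* Both sides equal [x^-1 * x']: inverting reverses the quotient, and conjugating by [x] restores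
     the order of the factors. *)
  have -> : x^-1 / x'^-1 = (x / x')^-1 ^ x.
    by rewrite conjgE invgF invgK mulgVK.
  by apply: conjN; [apply: eval_group_term2_subgroup | apply: subgroupV].
Qed.

End Subgroups.

Section GaloisConnection.
Local Open Scope group_scope.
Context {Q : leftQuasigroupType}.
Implicit Types (alpha beta : set (Q * Q)) (N : set (sym Q)).

Lemma LMlt_subgroup : subgroup (LMlt Q).
Proof. exact: generated_subgroup. Qed.

Lemma LMlt_ltrans (x : Q) : LMlt Q (ltrans x).
Proof. by apply: sub_gen_smallest; exists x. Qed.

(** The unit, inverses and products of [N] give reflexivity, symmetry and transitivity; normality
    and the spelling terms give compatibility with [lmul] and [ldiv]. *)
Lemma con_congruence N :
  spelling_property Q -> normal_subgroup (LMlt Q) N -> congruence (con N).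
Proof.
move=> [wp [wm spell]] nN; have [sN _ _] := nN.
have sL := LMlt_subgroup.
split; rewrite /con /=.
- by move=> x; rewrite mulgV; apply: subgroup1.
- by move=> x y Nxy; rewrite -invgF; apply: subgroupV.
- move=> x y z Nxy Nyz.
  by have := subgroupM sN Nxy Nyz; rewrite mulgA mulgVK.
- move=> x x' y y' Nx Ny; rewrite (spell x y).1 (spell x' y').1.
  by apply: (eval_group_term2_coset _ sL nN) => //; apply: LMlt_ltrans.
- move=> x x' y y' Nx Ny; rewrite (spell x y).2 (spell x' y').2.
  by apply: (eval_group_term2_coset _ sL nN) => //; apply: LMlt_ltrans.
Qed.

Lemma Dis_normal alpha : normal_subgroup (LMlt Q) (Dis alpha).
Proof.
apply: normal_closure_normal LMlt_subgroup _ => _ [[x y] _ <-] /=.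
by apply: subgroup_div LMlt_subgroup _ _; apply: LMlt_ltrans.
Qed.

(** [con N] is the preimage of [N] under the map sending (a, b) to the quotient of their
    translations, so both sides say that [N] contains the image of [alpha]. *)
Lemma Dis_sub_con {alpha N} :
  normal_subgroup (LMlt Q) N -> Dis alpha `<=` N <-> alpha `<=` con N.
Proof.
move=> nN; split=> [sDN ab alpha_ab | sub_alpha].
  by apply: sDN; apply: sub_gen_smallest; exists ab.
by apply: smallest_sub => // _ [ab alpha_ab <-]; apply: sub_alpha.
Qed.

Lemma Dis_mono alpha beta : alpha `<=` beta -> Dis alpha `<=` Dis beta.
Proof.
move=> sub_ab; apply/(Dis_sub_con (Dis_normal beta)).
(* The unit of the adjunction, [beta] inside [con (Dis beta)], is the transpose of the trivial
   inclusion of [Dis beta] in itself. *)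
by apply: subset_trans sub_ab _; apply/(Dis_sub_con (Dis_normal beta)).
Qed.

End GaloisConnection.

Theorem theorem6p5 (Q : leftQuasigroupType) (hQ : spelling_property Q) :
  [/\ (forall N : set (sym Q), normal_subgroup (LMlt Q) N -> congruence (con N)),
      (forall alpha : set (Q * Q), congruence alpha ->
         normal_subgroup (LMlt Q) (Dis alpha)),
      (forall alpha beta : set (Q * Q), congruence alpha -> congruence beta ->
         alpha `<=` beta -> Dis alpha `<=` Dis beta),
      (forall M N : set (sym Q),
         normal_subgroup (LMlt Q) M -> normal_subgroup (LMlt Q) N ->
         M `<=` N -> con M `<=` con N) &
      (forall (alpha : set (Q * Q)) (N : set (sym Q)),
         congruence alpha -> normal_subgroup (LMlt Q) N ->
         (Dis alpha `<=` N <-> alpha `<=` con N))].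
Proof.
split.
- by move=> N; apply: con_congruence.
- by move=> alpha _; apply: Dis_normal.
- by move=> alpha beta _ _; apply: Dis_mono.
(* Taking preimages under a fixed map preserves inclusion. *)
- by move=> M N _ _ sMN ab; apply: sMN.
- by move=> alpha N _; apply: Dis_sub_con.
Qed.
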